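(* Let $K,M$ be finite simplicial complexes, let $\phi:K\to M$ be a $2$-fold covering map, and let $i\ge 0$. Suppose that the weight functions satisfy $w_K(F)=w_M(\phi(F))$ for all $F\in K$. Let $\psi$ be a permutation assignment on $B_i(M)$ with values in $\mathbb{S}_2$ such that there is a graph isomorphism $\eta:B_i(M)^\psi\to B_i(K)$ with $\phi(\eta(G,j))=G$ for every vertex $(G,j)$ of $B_i(M)^\psi$. Let $s(F,\bar F)=\operatorname{sgn}\psi(F,\bar F)$ for $(F,\bar F)\in S_i(M)\times S_{i+1}(M)$ with $F\in\partial\bar F$. Then, as a multiset union (eigenvalues counted with multiplicity), $$\operatorname{Spec}\mathcal{L}_i^{\mathrm{up}}(K)=\operatorname{Spec}\mathcal{L}_i^{\mathrm{up}}(M)\cup\operatorname{Spec}\mathcal{L}_i^{\mathrm{up}}(M,s).$$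
   Context: Complexes. A complex $K$ is a collection of subsets of a finite set closed under inclusion, with $\emptyset\in K$ (dimension $-1$). $S_i(K)$ is the set of $i$-faces (faces with $i+1$ elements), $V(K)$ the vertex set. $K$ is connected if the graph formed by its vertices and $1$-faces is connected. For $\bar F\in S_{i+1}(K)$, $\partial\bar F$ is the set of $i$-faces contained in $\bar F$. Coverings. A simplicial map $\phi:K\to M$ is a map $V(K)\to V(M)$ sending faces to faces; $F\in\phi^{-1}(G)$ means $F\in K$ and $\phi(F)=G$. A covering map (all coverings are strong) is a simplicial map $\phi:K\to M$ such that: $K$ is connected; for each $G\in M$, the vertices of $K$ lying over $G$ are the union of the simplices $F\in\phi^{-1}(G)$, these simplices are pairwise disjoint, and each restriction $\phi|_F:F\to G$ is a bijection; and whenever $G\in S_i(M)$ is a face of $\bar G\in S_{i+1}(M)$, for each $F\in\phi^{-1}(G)$ there is $\bar F\in S_{i+1}(K)$ with $F\in\partial\bar F$ and $\phi(\bar F)=\bar G$. It is $k$-fold if every nonempty face $G$ of $M$ has exactly $k$ faces $F\in\phi^{-1}(G)$. Incidence and derived graphs. $B_i(K)$ is the bipartite graph with vertex set $S_i(K)\cup S_{i+1}(K)$ and edges $\{F,\bar F\}$ with $F\in S_i(K)$, $\bar F\in S_{i+1}(K)$, $F\in\partial\bar F$. With $[k]=\{1,\dots,k\}$ and $\mathbb{S}_k$ its symmetric group, a permutation assignment $\psi$ on a simple graph $B$ assigns to each ordered pair $(u,v)$ with $\{u,v\}\in E(B)$ an element $\psi(u,v)\in\mathbb{S}_k$, with $\psi(v,u)=\psi(u,v)^{-1}$.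 The derived graph $B^\psi$ has vertex set $V(B)\times[k]$, with $(u,a)$ adjacent to $(v,b)$ iff $\{u,v\}\in E(B)$ and $a=\psi(u,v)(b)$. Here $k=2$. Laplacians. Fix an orientation $[F]$ of every face (an ordering of vertices up to even permutations). If $[\bar F]=[v_0,\dots,v_{i+1}]$ and $F=\bar F\setminus\{v_j\}$, then $\operatorname{sgn}([F],\partial[\bar F])=(-1)^j$ if $[F]=[v_0,\dots,\hat v_j,\dots,v_{i+1}]$ and $-(-1)^j$ if $[F]$ is the opposite orientation; it is $0$ if $F\notin\partial\bar F$. Weight functions $w_K,w_M$ assign positive reals to all faces; $W_i(K)$ is the diagonal matrix of weights of $i$-faces. $D_i(K)$ is the matrix with rows indexed by $S_{i+1}(K)$, columns by $S_i(K)$ and entries $\operatorname{sgn}([F],\partial[\bar F])$. The $i$-up Laplace operator is (in matrix form) $\mathcal{L}_i^{\mathrm{up}}(K)=W_i(K)^{-1}D_i(K)^\top W_{i+1}(K)D_i(K)$; similarly for $M$. Incidence-signed complex. For signs $s(F,\bar F)\in\{-1,1\}$ given on pairs with $F\in\partial\bar F$ (and $s=0$ otherwise), let $D_i^s(M)$ have entries $\operatorname{sgn}([F],\partial[\bar F])\,s(F,\bar F)$; then $\mathcal{L}_i^{\mathrm{up}}(M,s)=W_i(M)^{-1}D_i^s(M)^\top W_{i+1}(M)D_i^s(M)$, with the weights $w_M$. Only the values of $s$ on $S_i(M)\times S_{i+1}(M)$ matter. *)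

(* Defs.v *)
From HB Require Import structures.
From mathcomp Require Import all_boot all_order all_algebra all_fingroup.
From mathcomp Require Import reals complex.

Set Implicit Arguments.
Unset Strict Implicit.
Unset Printing Implicit Defensive.

Import Order.TTheory GRing.Theory Num.Theory.
Local Open Scope ring_scope.

Section Complexes.
Variable T : finType.
Implicit Types (K : {set {set T}}) (F Fb : {set T}).

(* The vertices of [K] may form a proper subset of the ambient type [T]. *)
Definition is_complex K :=
  set0 \in K /\ forall F G : {set T}, F \in K -> G \subset F -> G \in K.

Definition vertices K : {set T} := [set v | [set v] \in K].

(* The empty face has dimension -1, so it belongs to no [faces i K]. *)
Definition faces (i : nat) K : {set {set T}} := [set F in K | #|F| == i.+1].

Definition connected_complex K :=
  {in vertices K &, forall x y,
    connect [rel u v | (u != v) && ([set u; v] \in K)] x y}.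

Definition boundary K Fb : {set {set T}} :=
  [set F in K | (F \subset Fb) && (#|Fb| == #|F|.+1)].

End Complexes.

Section Coverings.
Variables T U : finType.
Implicit Types (K : {set {set T}}) (M : {set {set U}}).

(* Maps on vertices are total functions [T -> U]; only their values on
   [vertices K] matter. *)
Definition simplicial_map K M (phi : T -> U) :=
  forall F, F \in K -> phi @: F \in M.

Definition fiber K (phi : T -> U) (G : {set U}) : {set {set T}} :=
  [set F in K | phi @: F == G].

(* Surjectivity of [phi : F -> G] is part of [F \in fiber K phi G]. In the last
   clause [G] may be the empty face. *)
Definition covering_map K M (phi : T -> U) :=
  [/\ simplicial_map K M phi,
      connected_complex K,
      forall G, G \in M ->
        [/\ [set v in vertices K | phi v \in G] = cover (fiber K phi G),
            trivIset (fiber K phi G)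
          & forall F, F \in fiber K phi G -> {in F &, injective phi}]
    & forall G Gb, Gb \in M -> G \in boundary M Gb ->
        forall F, F \in fiber K phi G ->
        exists2 Fb, Fb \in fiber K phi Gb & F \in boundary K Fb].

Definition kfold_covering_map (k : nat) K M (phi : T -> U) :=
  covering_map K M phi /\
  forall G, G \in M -> G != set0 -> #|fiber K phi G| = k.

End Coverings.

Record graph (A : finType) := Graph { gvert : {set A}; gedge : rel A }.

Section Graphs.
Variables (A : finType) (B : graph A) (k : nat).

(* The set {1, ..., k} is rendered as ['I_k]. Values of [psi] on pairs which are
   not edges are irrelevant. *)
Definition perm_assignment (psi : A -> A -> 'S_k) :=
  forall u v, gedge B u v -> psi v u = ((psi u v)^-1)%g.

Definition derived_graph (psi : A -> A -> 'S_k) : graph (A * 'I_k)%type :=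
  Graph (setX (gvert B) [set: 'I_k])
    [rel x y | gedge B x.1 y.1 && (x.2 == psi x.1 y.1 y.2)].

End Graphs.

Definition graph_iso (A A' : finType) (B : graph A) (B' : graph A')
    (eta : A -> A') :=
  [/\ {in gvert B &, injective eta},
      eta @: gvert B = gvert B'
    & {in gvert B &, forall x y, gedge B' (eta x) (eta y) = gedge B x y}].

Section Incidence.
Variables (T : finType) (i : nat) (K : {set {set T}}).

Definition incident (F Fb : {set T}) :=
  [&& F \in faces i K, Fb \in faces i.+1 K & F \in boundary K Fb].

Definition incidence_graph : graph {set T} :=
  Graph (faces i K :|: faces i.+1 K)
    [rel F G | incident F G || incident G F].

Lemma incidence_graph_sym : symmetric (gedge incidence_graph).
Proof. by move=> F G; rewrite /= orbC. Qed.

Lemma incidence_graph_irrefl : irreflexive (gedge incidence_graph).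
Proof.
by move=> F; rewrite /= orbb /incident [F \in boundary _ _]inE ltn_eqF ?andbF.
Qed.

End Incidence.

Section Orientations.
Variable T : finType.

(* An orientation is given by a representative ordering of each face. *)
Definition orientation (K : {set {set T}}) (o : {set T} -> seq T) :=
  forall F, F \in K -> uniq (o F) /\ o F =i F.

(* [s] and [t] differ by an even permutation. *)
Definition same_orientation (s t : seq T) : bool :=
  [exists p : 'S_(size s), ~~ odd_perm p &&
    (t == [seq tnth (in_tuple s) (p j) | j <- enum 'I_(size s)])].

(* [sgn([F], \partial[Fb])]. When [F = Fb :\ v], the orderings [o F] and
   [rem v (o Fb)] have the same vertices, so they are opposite as soon as they
   do not define the same orientation. *)
Definition incidence_sgn (R : pzRingType) (o : {set T} -> seq T)
    (F Fb : {set T}) : R :=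
  if [pick v in Fb | F == Fb :\ v] is Some v then
    let j := index v (o Fb) in
    if same_orientation (o F) (rem v (o Fb)) then (-1) ^+ j else - (-1) ^+ j
  else 0.

End Orientations.

Section Laplacians.
Variables (R : realType) (T : finType) (i : nat) (K : {set {set T}}).
Variables (o : {set T} -> seq T) (w : {set T} -> R).

Definition weight_function := forall F, F \in K -> 0 < w F.

Definition weight_mx (j : nat) : 'M[R]_#|faces j K| :=
  diag_mx (\row_a w (enum_val a)).

Definition coboundary_mx : 'M[R]_(#|faces i.+1 K|, #|faces i K|) :=
  \matrix_(a, b) incidence_sgn R o (enum_val b) (enum_val a).

Definition up_laplacian : 'M[R]_#|faces i K| :=
  invmx (weight_mx i) *m coboundary_mx^T *m weight_mx i.+1 *m coboundary_mx.

Variable s : {set T} -> {set T} -> R.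

Definition signed_coboundary_mx : 'M[R]_(#|faces i.+1 K|, #|faces i K|) :=
  \matrix_(a, b) (incidence_sgn R o (enum_val b) (enum_val a)
                  * s (enum_val b) (enum_val a)).

Definition signed_up_laplacian : 'M[R]_#|faces i K| :=
  invmx (weight_mx i) *m signed_coboundary_mx^T
    *m weight_mx i.+1 *m signed_coboundary_mx.

End Laplacians.

Definition assignment_sign (R : realType) (T : finType) (i k : nat)
    (K : {set {set T}}) (psi : {set T} -> {set T} -> 'S_k)
    (F Fb : {set T}) : R :=
  if incident i K F Fb then (-1) ^+ odd_perm (psi F Fb) else 0.

(* The complex eigenvalues of a real matrix, listed with algebraic
   multiplicity; as a multiset, it is to be compared up to [perm_eq]. *)
Definition spectrum (R : realType) (n : nat) (A : 'M[R]_n) : seq R[i] :=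
  sval (closed_field_poly_normal (char_poly (map_mx (real_complex R) A))).

(* Main.v *)
Require Import Defs.
From HB Require Import structures.
From mathcomp Require Import all_boot all_order all_algebra all_fingroup.
From mathcomp Require Import reals complex.
From mathcomp Require Import ring.

Set Implicit Arguments.
Unset Strict Implicit.
Unset Printing Implicit Defensive.

Import Order.TTheory GRing.Theory Num.Theory.
Local Open Scope ring_scope.

(** Up to orientation signs, the up Laplacian of a 2-fold cover preserves the
    even and the odd cochains along the fibres. Through [eta] the faces of [K] in
    dimensions [i] and [i.+1] are pairs (face of [M], sheet in {0, 1}), and an
    [i]-face lies in an [i.+1]-face of [K] exactly when the faces below are
    incident and their sheets are matched by [psi]. For [e] in {0, 1} let
    [chi e] be the corresponding character of the group with two elements, and
    let [Q e] send a cochain [u] on [M] to the cochain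
    [F |-> rho F * chi e (sheet of F) * u (phi @: F)] on [K]. Here [rho F = 1]
    if [phi] carries the chosen orientation of [F] to that of its image, and
    [rho F = -1] otherwise.

    Incidence signs are natural up to these corrections
    ([incidence_sgn_image]), and a permutation [p] of the two sheets acts on
    [chi e] by the scalar [(sgn p) ^ e] ([chi_perm]). Hence the coboundary of
    [K] composed with [Q e] is [Q e] composed with the coboundary of [M] whose
    entries are multiplied by [(sgn psi) ^ e] ([intertwine_lift_mx]). The same
    computation applies to the transposes, and [Q e] commutes with the weights
    because they are constant along fibres, so [Q e] intertwines the up
    Laplacians ([up_laplacian_lift]). For [e = 0] the Laplacian of [M] appears,
    for [e = 1] the incidence-signed one.

    Finally [Q 0] and [Q 1] have orthogonal columns of squared norm 2
    ([tr_lift_mx_mul]), and [K] has twice as many faces as [M] in each of the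
    two dimensions, so the block row [(Q 0, Q 1)] is invertible and conjugates
    the Laplacian of [K] to the direct sum. The characteristic polynomials then
    multiply, which gives the union of the spectra with multiplicities.

    The orientations enter only through [order_sgn], the sign of the
    permutation taking one ordering to another, written as the determinant of
    the matrix matching their entries. In this form composition of reorderings
    is the product of matrices, and deleting a vertex is a Laplace expansion. *)

(** * The sign of a reordering *)

Section OrderSign.
Variable R : realType.

Section OneType.
Variable T : eqType.
Implicit Types s t u : seq T.

Definition matching_mx n s t : 'M[R]_n :=
  \matrix_(a, b) (onth s a == onth t b)%:R.

(** When [t] is a rearrangement of the duplicate-free [s], the matching matrix
    is a permutation matrix; otherwise the value has no meaning. *)
Definition order_sgn s t : R := \det (matching_mx (size s) s t).

(** Each entry of [s] matches exactly one entry of the duplicate-free [u], so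
    the sum over the middle index has a single term. *)
Lemma matching_mx_mul n s u t :
    size s = n -> size u = n -> uniq u -> {subset s <= u} ->
  matching_mx n s u *m matching_mx n u t = matching_mx n s t.
Proof.
move=> sz_s sz_u Uu sub_su; apply/matrixP => a b; rewrite !mxE.
have: onth s a by rewrite onthTE sz_s.
case def_x: (onth s a) => [x|] // _.
have /sub_su/onthP[c def_c] : x \in s by apply/onthP; exists a.
have lt_cn : (c < n)%N by rewrite -sz_u -onthTE def_c.
rewrite (bigD1 (Ordinal lt_cn)) //= !mxE def_x def_c eqxx mul1r big1 ?addr0 //.
move=> d ne_dc; rewrite !mxE def_x -def_c.
case: eqP => [/(onth_inj _ _ _ Uu) eq_cd|_]; last by rewrite mul0r.
case/eqP: ne_dc; apply: val_inj => /=; apply/esym/eq_cd.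
by rewrite gtn_min sz_u lt_cn orbT.
Qed.

Lemma order_sgn_trans s u t : uniq u -> perm_eq s u -> perm_eq u t ->
  order_sgn s u * order_sgn u t = order_sgn s t.
Proof.
move=> Uu su ut; have sz := perm_size su.
rewrite /order_sgn -sz -det_mulmx matching_mx_mul //.
by move=> x; rewrite (perm_mem su).
Qed.

Lemma order_sgn_sym s t : perm_eq s t -> order_sgn s t = order_sgn t s.
Proof.
move=> st; rewrite /order_sgn -det_tr (perm_size st); congr (\det _).
by apply/matrixP => a b; rewrite !mxE eq_sym.
Qed.

Lemma order_sgn_tnth s (p : 'S_(size s)) : uniq s ->
  order_sgn s [seq tnth (in_tuple s) (p j) | j <- enum 'I_(size s)] = (-1) ^+ p.
Proof.
move=> Us; rewrite -det_perm -det_tr; congr (\det _).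
apply/matrixP => a b; rewrite !mxE onth_map.
have -> : onth (enum 'I_(size s)) b = Some b.
  apply/(@tnth_onth _ _ _ (ord_tuple _)); exact: tnth_ord_tuple.
have /tnth_onth /= -> : tnth (in_tuple s) a = tnth (in_tuple s) a by [].
rewrite /= (inj_eq Some_inj); congr (nat_of_bool _)%:R.
by rewrite eq_sym; apply/inj_eq/tuple_uniqP.
Qed.

End OneType.

(** Any rearrangement of [s] is induced by some permutation of the positions,
    so a failure of [same_orientation] can only mean that this permutation is
    odd. *)
Lemma order_sgnE (T : finType) (s t : seq T) : uniq s -> perm_eq s t ->
  order_sgn s t = (-1) ^+ ~~ same_orientation s t.
Proof.
move=> Us st; case: (boolP (same_orientation s t)) => [/existsP[p]|not_same].
  case/andP=> even_p /eqP ->; rewrite order_sgn_tnth //.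
  by rewrite (negbTE even_p).
have: perm_eq t (in_tuple s) by rewrite perm_sym.
case/tuple_permP=> p def_t; rewrite def_t order_sgn_tnth //; congr (_ ^+ _).
rewrite (_ : odd_perm p = true) //; apply: contraNT not_same => even_p.
by apply/existsP; exists p; rewrite even_p def_t; apply/eqP.
Qed.

Lemma order_sgn_sqr (T : finType) (s t : seq T) : uniq s -> perm_eq s t ->
  order_sgn s t * order_sgn s t = 1.
Proof. by move=> Us st; rewrite order_sgnE // -expr2 sqrr_sign. Qed.

Lemma order_sgn_map (T U : eqType) (f : T -> U) (s t : seq T) :
    perm_eq s t -> {in s &, injective f} ->
  order_sgn (map f s) (map f t) = order_sgn s t.
Proof.
move=> st inj_f; rewrite /order_sgn size_map; congr (\det _).
apply/matrixP => a b; rewrite !mxE !onth_map.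
case def_x: (onth s a) => [x|]; case def_y: (onth t b) => [y|] //=.
have sx : x \in s by apply/onthP; exists a.
have sy : y \in s by rewrite (perm_mem st); apply/onthP; exists b.
rewrite !(inj_eq Some_inj); congr (nat_of_bool _)%:R.
by apply/eqP/eqP => [/inj_f->|->].
Qed.

Lemma onth_rem (T : eqType) (x : T) (s : seq T) n : x \in s ->
  onth (rem x s) n = onth s (bump (index x s) n).
Proof.
elim: s n => //= y s IHs n; rewrite inE eq_sym.
case: eqVneq => [//|_] /= s_x; case: n => [|n] //=.
by rewrite IHs // bumpS.
Qed.

(** The row of the matching matrix at [x] has a single nonzero entry, in the
    column of [x]; the corresponding minor is the matching matrix of the two
    orderings with [x] deleted. *)
Lemma order_sgn_rem (T : eqType) (x : T) (s t : seq T) :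
    uniq s -> perm_eq s t -> x \in s ->
  order_sgn s t = (-1) ^+ (index x s + index x t) * order_sgn (rem x s) (rem x t).
Proof.
move=> Us st s_x.
have t_x : x \in t by rewrite -(perm_mem st).
have Ut : uniq t by rewrite -(perm_uniq st).
have onth_index (u : seq T) : x \in u -> onth u (index x u) = Some x.
  by move=> ux; rewrite onthE (nth_map x) ?index_mem // nth_index.
have lt_s : (index x s < size s)%N by rewrite index_mem.
have lt_t : (index x t < size s)%N by rewrite (perm_size st) index_mem.
rewrite /order_sgn (expand_det_row _ (Ordinal lt_s)).
rewrite (bigD1 (Ordinal lt_t)) //= big1 ?addr0 => [|b ne_b].
  rewrite mxE /= !onth_index // eqxx mul1r /cofactor /=; congr (_ * _).
  rewrite size_rem //; congr (\det _); apply/matrixP => a b.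
  by rewrite !mxE !onth_rem.
rewrite mxE /= onth_index // -(onth_index t) //.
case: eqP => [/(onth_inj _ _ _ Ut) eq_b|_]; last by rewrite mul0r.
case/eqP: ne_b; apply: val_inj => /=; apply/esym/eq_b.
by rewrite gtn_min index_mem t_x orbT.
Qed.

End OrderSign.

(** * Incidence signs under a map of vertices *)

Section IncidenceSign.
Variable R : realType.

Lemma index_map_in (T U : eqType) (f : T -> U) (s : seq T) x :
    {in s &, injective f} -> x \in s ->
  index (f x) (map f s) = index x s.
Proof.
elim: s => //= y s IHs inj_f; rewrite inE => s_x.
rewrite (inj_in_eq inj_f) ?inE ?eqxx //.
case: eqVneq s_x => //= _ s_x.
by rewrite IHs // => u v su sv; apply: inj_f; rewrite inE ?su ?sv orbT.
Qed.

Lemma rem_map_in (T U : eqType) (f : T -> U) (s : seq T) x :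
    {in s &, injective f} -> x \in s ->
  rem (f x) (map f s) = map f (rem x s).
Proof. by move=> inj_f s_x; rewrite !remE index_map_in // map_cat map_take map_drop. Qed.

Lemma incidence_sgnE (T : finType) (o : {set T} -> seq T) (Fb : {set T}) v :
    uniq (o Fb) -> o Fb =i Fb -> uniq (o (Fb :\ v)) -> o (Fb :\ v) =i Fb :\ v ->
    v \in Fb ->
  incidence_sgn R o (Fb :\ v) Fb
    = (-1) ^+ index v (o Fb) * order_sgn R (o (Fb :\ v)) (rem v (o Fb)).
Proof.
move=> Ub memb U_ mem_ Fb_v; rewrite /incidence_sgn.
case: pickP => [u /andP[Fb_u /eqP eq_vu]|/(_ v)]; last by rewrite Fb_v eqxx.
have {u Fb_u eq_vu} -> : u = v.
  apply/eqP; apply: contraT => ne_uv.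
  by move/setP/(_ u): eq_vu; rewrite !inE eqxx ne_uv Fb_u.
rewrite order_sgnE //; last first.
  apply: uniq_perm; rewrite ?rem_uniq // => x.
  by rewrite mem_ mem_rem_uniq // !inE memb.
by case: same_orientation; rewrite ?mulr1 // mulrN1.
Qed.

Variables (T U : finType) (phi : T -> U).
Variables (oK : {set T} -> seq T) (oM : {set U} -> seq U).

(** [1] if [phi] carries the orientation of [F] to that of its image, and [-1]
    if it carries it to the opposite one. *)
Definition relative_orientation (F : {set T}) : R :=
  order_sgn R (oM (phi @: F)) (map phi (oK F)).

Lemma perm_eq_image_order (F : {set T}) :
    uniq (oK F) -> oK F =i F ->
    uniq (oM (phi @: F)) -> oM (phi @: F) =i phi @: F ->
    {in F &, injective phi} ->
  perm_eq (oM (phi @: F)) (map phi (oK F)).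
Proof.
move=> UK memK UM memM inj_phi; apply: uniq_perm => //.
  by rewrite map_inj_in_uniq // => x y; rewrite !memK; apply: inj_phi.
move=> y; rewrite memM; apply/imsetP/mapP => -[x Fx ->]; exists x => //.
  by rewrite memK.
by rewrite -memK.
Qed.

(** Both incidence signs compare the ordering of a facet with that of the big
    face minus one vertex. Applying [phi] to the orderings upstairs changes no
    sign, and passing to the orderings downstairs costs the relative
    orientation of each of the two faces: [order_sgn_trans] for the facet, and
    [order_sgn_rem] for the big face, where the signs [(-1) ^+ index] of the
    two incidence numbers are absorbed. *)
Lemma incidence_sgn_image (K : {set {set T}}) (M : {set {set U}})
    (Fb : {set T}) v :
    orientation K oK -> orientation M oM ->
    Fb \in K -> Fb :\ v \in K -> phi @: Fb \in M -> phi @: (Fb :\ v) \in M ->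
    {in Fb &, injective phi} -> v \in Fb ->
  incidence_sgn R oK (Fb :\ v) Fb
    = relative_orientation (Fb :\ v) * relative_orientation Fb
      * incidence_sgn R oM (phi @: (Fb :\ v)) (phi @: Fb).
Proof.
move=> oKP oMP K_Fb K_F M_Gb M_G inj_phi Fb_v.
have [UFb memFb] := oKP _ K_Fb; have [UF memF] := oKP _ K_F.
have [UGb memGb] := oMP _ M_Gb; have [UG memG] := oMP _ M_G.
have inj_F : {in Fb :\ v &, injective phi}.
  by move=> x y /setD1P[_ Fx] /setD1P[_ Fy]; apply: inj_phi.
have inj_oFb : {in oK Fb &, injective phi}.
  by move=> x y; rewrite !memFb; apply: inj_phi.
have oFb_v : v \in oK Fb by rewrite memFb.
have image_F : phi @: (Fb :\ v) = phi @: Fb :\ phi v.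
  apply/setP=> y; apply/imsetP/setD1P => [[x /setD1P[ne_xv Fx] ->]|].
    by rewrite (inj_in_eq inj_phi) // imset_f.
  case=> ne_yv /imsetP[x Fx def_y]; exists x => //.
  by rewrite !inE Fx andbT; apply: contraNneq ne_yv => <-; rewrite def_y.
have permG := perm_eq_image_order UF memF UG memG inj_F.
have permGb := perm_eq_image_order UFb memFb UGb memGb inj_phi.
have oGb_v : phi v \in oM (phi @: Fb) by rewrite memGb imset_f.
have permF : perm_eq (oK (Fb :\ v)) (rem v (oK Fb)).
  apply: uniq_perm; rewrite ?rem_uniq // => x.
  by rewrite memF mem_rem_uniq // !inE memFb.
have perm_rem : perm_eq (rem (phi v) (oM (phi @: Fb)))
                        (rem (phi v) (map phi (oK Fb))).
  apply: uniq_perm; rewrite ?rem_uniq ?(perm_uniq permGb) -?(perm_uniq permGb) //.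
  by move=> y; rewrite !mem_rem_uniq ?inE -?(perm_uniq permGb) ?(perm_mem permGb).
have permG' : perm_eq (oM (phi @: (Fb :\ v))) (rem (phi v) (oM (phi @: Fb))).
  apply: uniq_perm; rewrite ?rem_uniq // => y.
  by rewrite memG mem_rem_uniq // image_F !inE memGb.
have inj_oF : {in oK (Fb :\ v) &, injective phi}.
  by move=> x y; rewrite !memF; apply: inj_F.
rewrite incidence_sgnE // image_F incidence_sgnE -?image_F ?imset_f //.
rewrite -(order_sgn_map R permF inj_oF) -rem_map_in //.
rewrite -(order_sgn_trans R _ _ perm_rem) ?rem_uniq //; last first.
  by rewrite perm_sym in permG; apply: perm_trans permG _.
rewrite -(order_sgn_trans R UG _ permG') 1?perm_sym //.
rewrite /relative_orientation (order_sgn_rem R UGb permGb oGb_v).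
rewrite -(order_sgn_sym R permG) index_map_in // exprD.
set a := (-1) ^+ index (phi v) _; have a2 : a * a = 1 by rewrite -expr2 sqrr_sign.
by ring: a2.
Qed.

End IncidenceSign.

(** * Intertwined matrices and their spectra *)

Section SimilarSpectra.

(** The dimensions are kept distinct because they are cardinals of different
    sets of faces. *)
Lemma char_poly_intertwine (R : comNzRingType) (m n : nat)
    (A : 'M[R]_m) (B : 'M[R]_n) (P : 'M[R]_(n, m)) (Q : 'M[R]_(m, n)) :
    m = n -> P *m Q = 1%:M -> A *m Q = Q *m B ->
  char_poly A = char_poly B.
Proof.
move=> eq_mn; case: n / eq_mn in B P Q * => PQ AQ.
have QP := mulmx1C PQ.
have defA : A = Q *m B *m P by rewrite -AQ -mulmxA QP mulmx1.
pose toP := @polyC R.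
have QP_X : map_mx toP Q *m map_mx toP P = 1%:M by rewrite -map_mxM QP map_mx1.
have defA' : char_poly_mx A = map_mx toP Q *m char_poly_mx B *m map_mx toP P.
  rewrite /char_poly_mx defA !map_mxM mulmxBr mulmxBl mul_mx_scalar.
  by rewrite -scalemxAl QP_X scalemx1.
by rewrite /char_poly defA' !det_mulmx mulrAC -det_mulmx QP_X det1 mul1r.
Qed.

Lemma char_poly_block_diag (R : comNzRingType) (m n : nat)
    (A : 'M[R]_m) (B : 'M[R]_n) :
  char_poly (block_mx A 0 0 B) = char_poly A * char_poly B.
Proof. by rewrite /char_poly char_block_diag_mx det_lblock. Qed.

Lemma spectrumP (R : realType) (n : nat) (A : 'M[R]_n) :
  map_poly (real_complex R) (char_poly A) = \prod_(z <- spectrum A) ('X - z%:P).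
Proof.
rewrite map_char_poly /spectrum; case: closed_field_poly_normal => r /= {1}->.
by rewrite (monicP (char_poly_monic _)) scale1r.
Qed.

Lemma perm_spectrum_cat (R : realType) (m n p : nat)
    (A : 'M[R]_m) (B : 'M[R]_n) (C : 'M[R]_p) :
  char_poly A = char_poly B * char_poly C ->
  perm_eq (spectrum A) (spectrum B ++ spectrum C).
Proof.
by move=> eqA; apply: prod_XsubC_eq; rewrite big_cat -!spectrumP eqA rmorphM.
Qed.

End SimilarSpectra.

(** * Even and odd lifts along a double cover *)

Section DoubleLift.
Variable R : realType.

Lemma perm_I2 (p : 'S_2) : p = 1%g \/ p = tperm ord0 ord_max.
Proof.
have I2 (a : 'I_2) : a = ord0 \/ a = ord_max.
  by case: a => [[|[|a]] lt_a] //; [left|right]; apply: val_inj.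
have ne01 : ord0 != ord_max :> 'I_2 by [].
case: (I2 (p ord0)) (I2 (p ord_max)) => p0 [] p1.
- by move: ne01; rewrite -(inj_eq (@perm_inj _ p)) p0 p1.
- by left; apply/permP => a; case: (I2 a) => ->; rewrite perm1.
- by right; apply/permP => a; case: (I2 a) => ->; rewrite ?tpermL ?tpermR.
by move: ne01; rewrite -(inj_eq (@perm_inj _ p)) p0 p1.
Qed.

(** The trivial character of the group with two elements for [e = false], the
    nontrivial one for [e = true]. *)
Definition chi (e : bool) (a : 'I_2) : R := (-1) ^+ (e * a).

(** Permutations of two sheets act by translations of the group with two
    elements, so characters are eigenvectors; this is where the cover has to be
    2-fold. *)
Lemma chi_perm e (p : 'S_2) a : chi e (p a) = chi e a * (-1) ^+ (e * odd_perm p).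
Proof.
case: (perm_I2 p) => ->; first by rewrite perm1 odd_perm1 muln0 mulr1.
rewrite odd_tperm /chi; case: e; last by rewrite !mul0n mulr1.
case: a => [[|[|a]] lt_a] //.
  have ->: Ordinal lt_a = ord0 by apply: val_inj.
  by rewrite tpermL /= mul1r.
have ->: Ordinal lt_a = ord_max by apply: val_inj.
by rewrite tpermR /= !mul1n mulrNN mulr1.
Qed.

Variables (X Y : finType) (lift : Y * 'I_2 -> X) (rho : X -> R).
Implicit Types (A : {set X}) (B : {set Y}).

(** [lift (y, a)] is the point over [y] on the sheet [a]. *)
Definition double_cover A B :=
  {in setX B [set: 'I_2] &, injective lift} /\ lift @: setX B [set: 'I_2] = A.

(** The matrix of the operator multiplying a pulled back function by [rho] and
    by the character of the sheet. The sum has at most one nonzero term and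
    spares a name for the projection of [X] and for the sheet of a point. *)
Definition lift_mx A B (e : bool) : 'M[R]_(#|A|, #|B|) :=
  \matrix_(f, g) \sum_a
    (enum_val f == lift (enum_val g, a))%:R * (rho (enum_val f) * chi e a).

Lemma card_double_cover A B : double_cover A B -> #|A| = (#|B| + #|B|)%N.
Proof.
by case=> inj <-; rewrite card_in_imset // cardsX cardsT card_ord muln2 addnn.
Qed.

Lemma mem_lift A B y a : double_cover A B -> y \in B -> lift (y, a) \in A.
Proof. by case=> _ <- By; apply: imset_f; rewrite inE By inE. Qed.

Lemma liftP A B x : double_cover A B -> x \in A ->
  exists y a, y \in B /\ x = lift (y, a).
Proof.
case=> _ <- /imsetP[[y a] /setXP[By _] ->]; by exists y, a.
Qed.

Lemma lift_inj A B y y' a a' : double_cover A B -> y \in B -> y' \in B ->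
  (lift (y, a) == lift (y', a')) = (y == y') && (a == a').
Proof.
by case=> inj _ By By'; rewrite (inj_in_eq inj) ?inE ?By ?By' //= xpair_eqE.
Qed.

Lemma sum_lift_mx A B e g (h : X -> R) : double_cover A B ->
  \sum_f h (enum_val f) * lift_mx A B e f g
    = \sum_a h (lift (enum_val g, a)) * rho (lift (enum_val g, a)) * chi e a.
Proof.
move=> covAB; pose t a x := h x * ((x == lift (enum_val g, a))%:R * (rho x * chi e a)).
under eq_bigr do rewrite mxE big_distrr /=.
rewrite exchange_big /=; apply: eq_bigr => a _.
rewrite -(big_enum_val (t a)) /t (bigD1 (lift (enum_val g, a))) /=; last first.
  exact: (mem_lift _ covAB (enum_valP g)).
rewrite eqxx mul1r mulrA big1 ?addr0 // => x /andP[_ /negbTE ->].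
by rewrite mul0r mulr0.
Qed.

Lemma lift_mx_lift A B e f g y a : double_cover A B -> y \in B ->
    enum_val f = lift (y, a) ->
  lift_mx A B e f g = (y == enum_val g)%:R * (rho (lift (y, a)) * chi e a).
Proof.
move=> covAB By def_f; rewrite mxE def_f (bigD1 a) //= big1 => [|b ne_ba].
  by rewrite (lift_inj _ _ covAB) ?enum_valP // eqxx andbT addr0.
by rewrite (lift_inj _ _ covAB) ?enum_valP // (eq_sym a) (negbTE ne_ba) andbF mul0r.
Qed.

(** On the two points of a fibre [rho] cancels, which leaves the orthogonality
    relations of the two characters. *)
Lemma tr_lift_mx_mul A B e e' : double_cover A B ->
    {in A, forall x, rho x * rho x = 1} ->
  (lift_mx A B e)^T *m lift_mx A B e' = (2 * (e == e')%:R)%:M.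
Proof.
move=> covAB rho2; apply/matrixP => g g'; rewrite !mxE.
under eq_bigr => f _ do rewrite mxE.
pose h x := \sum_a (x == lift (enum_val g, a))%:R * (rho x * chi e a).
transitivity (\sum_f h (enum_val f) * lift_mx A B e' f g').
  by apply: eq_bigr => f _; rewrite mxE.
rewrite sum_lift_mx //.
transitivity (\sum_a (g == g')%:R * (chi e a * chi e' a)).
  apply: eq_bigr => a _; have Ag := mem_lift a covAB (enum_valP g').
  rewrite /h (bigD1 a) //= big1 ?addr0 => [|b ne_ba].
    rewrite (lift_inj _ _ covAB) ?enum_valP // eqxx andbT (inj_eq enum_val_inj).
    have r2 := rho2 _ Ag. by rewrite [g' == g]eq_sym; ring: r2.
  by rewrite (lift_inj _ _ covAB) ?enum_valP // (eq_sym a) (negbTE ne_ba) andbF mul0r.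
rewrite -big_distrr /= big_ord_recl big_ord1 /chi /= !muln0 mulr1 mulr_natl -mulrnAr.
clear h; case: eqP => _; case: e; case: e' => /=; rewrite ?mulr0n ?mulr1n /=; ring.
Qed.

Lemma diag_lift_mx A B e (wX : X -> R) (wY : Y -> R) : double_cover A B ->
    {in B, forall y a, wX (lift (y, a)) = wY y} ->
  diag_mx (\row_f wX (enum_val f)) *m lift_mx A B e
    = lift_mx A B e *m diag_mx (\row_g wY (enum_val g)).
Proof.
move=> covAB eqw; apply/matrixP => f g; rewrite mul_diag_mx mul_mx_diag !mxE.
have [y [a [By def_f]]] := liftP covAB (enum_valP f).
have := lift_mx_lift e g covAB By def_f; rewrite mxE => ->.
rewrite def_f eqw //; case: eqP => [->|_]; first by rewrite mulrC.
by rewrite !mul0r mulr0.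
Qed.

(** In the row of [lift (y', a')], only the sheet [p y y' a'] over [y]
    contributes: [rho] at that point cancels against the factor in [d], and
    [chi_perm] turns the character of that sheet into the character of [a']
    times the power of the sign of [p y y']. *)
Lemma intertwine_lift_mx A A' B B' e (d : X -> X -> R) (m : Y -> Y -> R)
    (p : Y -> Y -> 'S_2) :
    double_cover A B -> double_cover A' B' ->
    {in A, forall x, rho x * rho x = 1} ->
    (forall y y' a a', y \in B -> y' \in B' ->
       d (lift (y, a)) (lift (y', a')) =
         rho (lift (y, a)) * rho (lift (y', a')) * m y y' * (a == p y y' a')%:R) ->
  (\matrix_(f', f) d (enum_val f) (enum_val f')) *m lift_mx A B e
    = lift_mx A' B' e
      *m \matrix_(g', g) (m (enum_val g) (enum_val g')
           * (-1) ^+ (e * odd_perm (p (enum_val g) (enum_val g')))).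
Proof.
move=> cov cov' rho2 d_lift; apply/matrixP => f' g; rewrite !mxE.
have [y' [a' [By' def_f']]] := liftP cov' (enum_valP f').
have By := enum_valP g.
have [g' def_y'] : exists g' : 'I_#|B'|, y' = enum_val g'.
  by exists (enum_rank_in By' y'); rewrite enum_rankK_in.
pose h x := d x (lift (y', a')).
transitivity (\sum_f h (enum_val f) * lift_mx A B e f g).
  by apply: eq_bigr => f _; rewrite mxE def_f'.
rewrite sum_lift_mx // [RHS](bigD1 g') //= [X in _ = _ + X]big1 ?addr0 => [|k ne_k]; last first.
  rewrite (lift_mx_lift e k cov' By' def_f') def_y' (inj_eq enum_val_inj).
  by rewrite eq_sym (negbTE ne_k) !mul0r.
rewrite (lift_mx_lift e g' cov' By' def_f') -def_y' eqxx mul1r mxE -def_y'.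
rewrite (bigD1 (p (enum_val g) y' a')) //= big1 ?addr0 => [|a ne_a].
  have := rho2 _ (mem_lift (p (enum_val g) y' a') cov By).
  rewrite /h d_lift // eqxx chi_perm mulr1.
  move: (rho _) (rho _) (m _ _) (chi e a') ((-1) ^+ _ : R) => r r' c x z r2.
  by ring: r2.
by rewrite /h d_lift // (negbTE ne_a) mulr0 !mul0r.
Qed.

End DoubleLift.

(** * Splitting of the up Laplacian *)

Section LaplacianLift.
Variable R : realType.

Lemma intertwine_invmx (m n : nat) (W : 'M[R]_m) (w : 'M[R]_n) (Q : 'M[R]_(m, n)) :
    W \in unitmx -> w \in unitmx -> W *m Q = Q *m w ->
  invmx W *m Q = Q *m invmx w.
Proof.
move=> uW uw WQ; rewrite -{1}[Q](mulmxK uw) -WQ !mulmxA.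
by rewrite (mulVmx uW) mul1mx.
Qed.

Lemma weight_mx_unit (T : finType) (i : nat) (K : {set {set T}}) (w : {set T} -> R) :
  weight_function K w -> weight_mx K w i \in unitmx.
Proof.
move=> w_gt0; rewrite unitmxE det_diag unitfE prodf_seq_neq0.
apply/allP => a _ /=; rewrite mxE; apply/lt0r_neq0/w_gt0.
by have := enum_valP a; rewrite inE => /andP[].
Qed.

Variables (T U : finType) (K : {set {set T}}) (M : {set {set U}}) (i : nat).
Variables (oK : {set T} -> seq T) (oM : {set U} -> seq U).
Variables (wK : {set T} -> R) (wM : {set U} -> R).
Variables (psi : {set U} -> {set U} -> 'S_2).
Variables (eta : {set U} * 'I_2 -> {set T}) (rho : {set T} -> R).

(** The coboundary of [M] for [e = false], and the incidence-signed one for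
    [e = true]. *)
Definition twisted_coboundary_mx e : 'M[R]_(#|faces i.+1 M|, #|faces i M|) :=
  \matrix_(b, a) (incidence_sgn R oM (enum_val a) (enum_val b)
                  * (-1) ^+ (e * odd_perm (psi (enum_val a) (enum_val b)))).

Definition twisted_up_laplacian e : 'M[R]_#|faces i M| :=
  invmx (weight_mx M wM i) *m (twisted_coboundary_mx e)^T
    *m weight_mx M wM i.+1 *m twisted_coboundary_mx e.

Hypotheses (wK_gt0 : weight_function K wK) (wM_gt0 : weight_function M wM).
Hypotheses (cov : double_cover eta (faces i K) (faces i M))
           (cov' : double_cover eta (faces i.+1 K) (faces i.+1 M)).
Hypothesis rho2 : {in K, forall F, rho F * rho F = 1}.
Hypothesis sgn_lift : forall G Gb a b, G \in faces i M -> Gb \in faces i.+1 M ->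
  incidence_sgn R oK (eta (G, a)) (eta (Gb, b))
    = rho (eta (G, a)) * rho (eta (Gb, b)) * incidence_sgn R oM G Gb
      * (a == psi G Gb b)%:R.
Hypothesis eq_w : forall j G a, j \in [:: i; i.+1] -> G \in faces j M ->
  wK (eta (G, a)) = wM G.

Lemma faces_sqr j : {in faces j K, forall F, rho F * rho F = 1}.
Proof. by move=> F; rewrite inE => /andP[KF _]; apply: rho2. Qed.

Let Q e := lift_mx eta rho (faces i K) (faces i M) e.
Let Q' e := lift_mx eta rho (faces i.+1 K) (faces i.+1 M) e.

Lemma coboundary_lift e :
  coboundary_mx R i K oK *m Q e = Q' e *m twisted_coboundary_mx e.
Proof. exact: (intertwine_lift_mx e cov cov' (faces_sqr (j:=i)) sgn_lift). Qed.

(** The hypothesis of [intertwine_lift_mx] is symmetric in the two levels: from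
    the side of the larger face, the sheets are matched by the inverse
    permutation, which has the same sign. *)
Lemma boundary_lift e :
  (coboundary_mx R i K oK)^T *m Q' e = Q e *m (twisted_coboundary_mx e)^T.
Proof.
have sgn_lift' Gb G b a : Gb \in faces i.+1 M -> G \in faces i M ->
    incidence_sgn R oK (eta (G, a)) (eta (Gb, b))
      = rho (eta (Gb, b)) * rho (eta (G, a)) * incidence_sgn R oM G Gb
        * (b == (psi G Gb)^-1%g a)%:R.
  move=> MGb MG; rewrite sgn_lift // [rho (eta (G, a)) * _]mulrC.
  congr (_ * (nat_of_bool _)%:R).
  by rewrite -(inj_eq (@perm_inj _ (psi G Gb)) b) permKV eq_sym.
rewrite (_ : (coboundary_mx R i K oK)^T
  = \matrix_(a, b) incidence_sgn R oK (enum_val a) (enum_val b)).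
  rewrite (_ : (twisted_coboundary_mx e)^T = \matrix_(a, b)
      (incidence_sgn R oM (enum_val a) (enum_val b)
       * (-1) ^+ (e * odd_perm (psi (enum_val a) (enum_val b))^-1%g))).
    exact: (intertwine_lift_mx (d := fun Fb F => incidence_sgn R oK F Fb)
      (m := fun Gb G => incidence_sgn R oM G Gb) e cov' cov (faces_sqr (j:=i.+1))
      sgn_lift').
  by apply/matrixP=> a b; rewrite !mxE odd_permV.
by apply/matrixP=> a b; rewrite !mxE.
Qed.

(** [Q e] and [Q' e] are moved to the left through the four factors of the
    Laplacian, one after the other. *)
Lemma up_laplacian_lift e :
  up_laplacian i K oK wK *m Q e = Q e *m twisted_up_laplacian e.
Proof.
have WQ j : j \in [:: i; i.+1] -> double_cover eta (faces j K) (faces j M) ->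
    weight_mx K wK j *m lift_mx eta rho (faces j K) (faces j M) e
    = lift_mx eta rho (faces j K) (faces j M) e *m weight_mx M wM j.
  by move=> ij covj; apply: diag_lift_mx => // G MG a; apply: eq_w MG.
rewrite /up_laplacian -[_ *m Q e]mulmxA coboundary_lift !mulmxA.
rewrite -[_ *m Q' e]mulmxA WQ ?inE ?eqxx ?orbT // !mulmxA.
rewrite -[_ *m Q' e]mulmxA boundary_lift !mulmxA.
rewrite (intertwine_invmx (weight_mx_unit i wK_gt0) (weight_mx_unit i wM_gt0)) //.
by rewrite WQ ?inE ?eqxx.
Qed.

(** By orthogonality and equality of dimensions, half the transpose of the
    block row [S] is its inverse. *)
Lemma char_poly_up_laplacian_lift :
  char_poly (up_laplacian i K oK wK)
    = char_poly (twisted_up_laplacian false) * char_poly (twisted_up_laplacian true).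
Proof.
rewrite -char_poly_block_diag.
pose S := row_mx (Q false) (Q true).
apply: (@char_poly_intertwine _ _ _ _ _ (2^-1 *: S^T) S).
- exact: card_double_cover cov.
- rewrite -scalemxAl /S tr_row_mx mul_col_row !tr_lift_mx_mul //; try exact: faces_sqr.
  rewrite /= !mulr0 raddf0 mulr1 -scalar_mx_block scale_scalar_mx mulVf //.
  by rewrite pnatr_eq0.
by rewrite mul_mx_row mul_row_block !mulmx0 addr0 add0r !up_laplacian_lift.
Qed.

End LaplacianLift.

(** * Incident faces *)

Section Incidence.
Variables (R : realType) (T : finType) (i : nat) (K : {set {set T}}).
Implicit Types F Fb : {set T}.

Lemma incidentP F Fb : incident i K F Fb -> exists2 v, v \in Fb & F = Fb :\ v.
Proof.
case/and3P=> _ _; rewrite inE => /and3P[_ sFFb /eqP cardFb].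
have /cards1P[v def_v] : #|Fb :\: F| == 1%N.
  by rewrite cardsD (setIidPr sFFb) cardFb subSnn.
exists v; first by have := set11 v; rewrite -def_v inE => /andP[].
by rewrite -def_v setDDr setDv set0U (setIidPr sFFb).
Qed.

Lemma incidence_sgn0 (o : {set T} -> seq T) F Fb :
    F \in faces i K -> Fb \in faces i.+1 K -> ~~ incident i K F Fb ->
  incidence_sgn R o F Fb = 0.
Proof.
move=> KF KFb; rewrite /incident KF KFb inE /incidence_sgn.
case: pickP => // v /andP[Fb_v /eqP def_F]; case/negP.
move: KF KFb; rewrite !inE => /andP[-> _] _ /=.
by rewrite def_F subsetDl /= (cardsD1 v Fb) Fb_v.
Qed.

(** Edges of the incidence graph are unoriented, but the dimensions tell which
    end is the smaller face. *)
Lemma edge_incident F Fb : Fb \in faces i.+1 K ->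
  gedge (incidence_graph i K) F Fb = incident i K F Fb.
Proof.
rewrite inE => /andP[_ /eqP cardFb] /=.
have /negbTE-> : ~~ incident i K Fb F; last by rewrite orbF.
apply: contraTN isT => /and3P[]; rewrite inE cardFb => /andP[_].
by rewrite eqSS -[X in _ == X]addn0 -addn1 eqn_add2l.
Qed.

End Incidence.

(** * The spectrum of a 2-fold cover *)

Theorem theorem1p7 (R : realType) (T U : finType)
    (K : {set {set T}}) (M : {set {set U}}) (phi : T -> U) (i : nat)
    (oK : {set T} -> seq T) (oM : {set U} -> seq U)
    (wK : {set T} -> R) (wM : {set U} -> R)
    (psi : {set U} -> {set U} -> 'S_2) (eta : {set U} * 'I_2 -> {set T}) :
  is_complex K -> is_complex M ->
  kfold_covering_map 2 K M phi ->
  orientation K oK -> orientation M oM ->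
  weight_function K wK -> weight_function M wM ->
  (forall F, F \in K -> wK F = wM (phi @: F)) ->
  perm_assignment (incidence_graph i M) psi ->
  graph_iso (derived_graph (incidence_graph i M) psi) (incidence_graph i K) eta ->
  (forall G j, (G, j) \in gvert (derived_graph (incidence_graph i M) psi) ->
     phi @: eta (G, j) = G) ->
  perm_eq (spectrum (up_laplacian i K oK wK))
          (spectrum (up_laplacian i M oM wM)
           ++ spectrum (signed_up_laplacian i M oM wM
                          (assignment_sign R i M psi))).
Proof.
move=> _ _ [[simp _ fibers _] _] oKP oMP wK_gt0 wM_gt0 eq_w _ [eta_inj eta_im eta_edge].
move=> phi_eta.
have inj_phi F : F \in K -> {in F &, injective phi}.
  move=> KF; have [_ _] := fibers _ (simp _ KF); apply.
  by rewrite inE KF eqxx.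
have faceK j F : F \in faces j K -> F \in K by rewrite inE => /andP[].
have faceM j G : G \in faces j M -> G \in M by rewrite inE => /andP[].
have vertM j G a : j \in [:: i; i.+1] -> G \in faces j M ->
    (G, a) \in gvert (derived_graph (incidence_graph i M) psi).
  by rewrite !inE => /orP[] /eqP->; rewrite andbT => -> //; rewrite orbT.
have phiE j G a : j \in [:: i; i.+1] -> G \in faces j M -> phi @: eta (G, a) = G.
  by move=> ij MG; apply/phi_eta/(vertM j).
(* [phi] is injective on [eta (G, a)], so a lift has the dimension of its
   image and [eta] respects the two parts of the incidence graph. *)
have eta_face j G a : j \in [:: i; i.+1] -> G \in faces j M -> eta (G, a) \in faces j K.
  move=> ij MG; have KF : eta (G, a) \in K.
    have: eta (G, a) \in gvert (incidence_graph i K).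
      by rewrite -eta_im imset_f // (vertM j).
    by case/setUP => /faceK.
  move: (MG); rewrite !inE KF -(card_in_imset (inj_phi _ KF)) (phiE j) //.
  by case/andP.
have cov j : j \in [:: i; i.+1] -> double_cover eta (faces j K) (faces j M).
  move=> ij; split=> [[G a] [G' a'] /setXP[MG _] /setXP[MG' _]|].
    by apply: eta_inj; apply: (vertM j).
  apply/setP=> F; apply/imsetP/idP => [[[G a] /setXP[MG _] ->]|KF].
    exact: eta_face.
  have: F \in eta @: gvert (derived_graph (incidence_graph i M) psi).
    by rewrite eta_im; move: ij KF; rewrite !inE => /orP[] /eqP-> ->; rewrite ?orbT.
  case/imsetP=> -[G a] vGa def_F; exists (G, a) => //.
  rewrite inE [X in _ && X]inE andbT /= inE.
  move: KF; rewrite inE => /andP[KF cardF].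
  by rewrite -(phi_eta _ _ vGa) -def_F simp // card_in_imset //; apply: inj_phi.
have [i_i i_i1] : i \in [:: i; i.+1] /\ i.+1 \in [:: i; i.+1].
  by rewrite !inE !eqxx orbT.
pose rho := relative_orientation R phi oK oM.
have rho2 : {in K, forall F, rho F * rho F = 1}.
  move=> F KF; have [UF memF] := oKP _ KF; have [UG memG] := oMP _ (simp _ KF).
  by apply: order_sgn_sqr => //; apply: perm_eq_image_order => //; apply: inj_phi.
(* Edges of the derived graph say which lifts are incident, and then
   [incidence_sgn_image] gives the sign. *)
have sgn_lift G Gb a b : G \in faces i M -> Gb \in faces i.+1 M ->
    incidence_sgn R oK (eta (G, a)) (eta (Gb, b))
      = rho (eta (G, a)) * rho (eta (Gb, b)) * incidence_sgn R oM G Gb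
        * (a == psi G Gb b)%:R.
  move=> MG MGb; have KF := eta_face _ _ a i_i MG; have KFb := eta_face _ _ b i_i1 MGb.
  have edge : incident i K (eta (G, a)) (eta (Gb, b))
      = incident i M G Gb && (a == psi G Gb b).
    rewrite -edge_incident // eta_edge; first by rewrite -edge_incident.
      exact: vertM MG.
    exact: vertM MGb.
  case: (boolP (incident i K _ _)) edge => [inc|not_inc] edge.
    have /andP[_ ->] : incident i M G Gb && (a == psi G Gb b) by rewrite -edge.
    rewrite mulr1.
    have [v Fb_v def_F] := incidentP inc.
    rewrite -[X in incidence_sgn R oM X _](phiE i G a i_i MG).
    rewrite -[X in incidence_sgn R oM _ X](phiE i.+1 Gb b i_i1 MGb) def_F.
    apply: (incidence_sgn_image R oKP oMP) => //; rewrite -?def_F.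
    - exact: faceK KFb.
    - exact: faceK KF.
    - by rewrite (phiE i.+1) // (faceM i.+1).
    - by rewrite (phiE i) // (faceM i).
    by apply: inj_phi; apply: faceK KFb.
  rewrite (incidence_sgn0 R oK KF KFb not_inc).
  case: eqP edge => [_|_ _]; last by rewrite mulr0.
  rewrite andbT => /esym/negbT not_incM.
  by rewrite (incidence_sgn0 R oM MG MGb not_incM) mulr0 mul0r.
have eq_w' j G a : j \in [:: i; i.+1] -> G \in faces j M -> wK (eta (G, a)) = wM G.
  by move=> ij MG; rewrite eq_w ?(phiE j) // (faceK j) // eta_face.
apply: perm_spectrum_cat.
rewrite (char_poly_up_laplacian_lift wK_gt0 wM_gt0 (cov _ i_i) (cov _ i_i1)
           rho2 sgn_lift eq_w').
congr (_ * _).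
  rewrite /twisted_up_laplacian /up_laplacian.
  rewrite (_ : twisted_coboundary_mx _ _ _ _ _ _ = coboundary_mx R i M oM) //.
  by apply/matrixP => a b; rewrite !mxE mulr1.
rewrite /twisted_up_laplacian /signed_up_laplacian.
rewrite (_ : twisted_coboundary_mx _ _ _ _ _ _ =
  signed_coboundary_mx i M oM (assignment_sign R i M psi)) //.
apply/matrixP => a b; rewrite !mxE /assignment_sign mul1n.
(* Off the incident pairs [assignment_sign] is zero and the character is not,
   but the incidence sign vanishes. *)
case: ifPn => // not_inc.
by rewrite (incidence_sgn0 R oM (enum_valP b) (enum_valP a) not_inc) !mul0r.
Qed.
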